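(* Consider any allocation process of balls into $n$ bins which satisfies conditions $\mathcal{P}_1$ and $\mathcal{W}_1$ (defined in the context) at every round. Then there is a constant $C>0$ such that for any $m \geq 1$, \[ \Pr\bigl[\mathrm{Gap}(m) \leq C \log n\bigr] \geq 1-n^{-2}. \]
   Context: There are $n$ bins; $x^t=(x^t_1,\dots,x^t_n)$ is the load vector after round $t$ (with $x^0=0$), $W^t=\sum_i x_i^t$ is the total number of balls allocated by round $t$ (a round may allocate several balls), $y_i^t = x_i^t - W^t/n$ is the normalized load, and $\mathrm{Gap}(t)=\max_i x_i^t - W^t/n$. $\mathfrak{F}^t$ is the filtration of the first $t$ rounds. Condition $\mathcal{P}_1$: in each round $t$, with an arbitrary labeling of the bins such that $y_1^t\ge y_2^t\ge\dots\ge y_n^t$, a bin $i=i^t$ is sampled according to a distribution vector $p^t=(p^t_1,\dots,p^t_n)$ (which may depend on $\mathfrak{F}^t$) that is majorized by the uniform distribution, i.e. $\sum_{j=1}^k p_j^t \le k/n$ for all $1\le k\le n$. Condition $\mathcal{W}_1$: in each round $t$, with $i$ the sampled bin: if $y_i^t<0$, exactly $\lceil -y_i^t\rceil+1\ge 2$ balls are allocated (possibly to bins other than $i$, possibly depending on $\mathfrak{F}^t$) such that there are at most two bins $k_1,k_2$ where $k_1$ receives $\lceil -y_{k_1}^t\rceil+1$ balls, $k_2$ receives $\lceil -y_{k_2}^t\rceil$ balls, and every other bin $j$ receives at most $\lceil -y_j^t\rceil - 1$ balls; if $y_i^t\ge 0$, a single ball is allocated to bin $i$. Statements are asserted for all sufficiently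 large $n$. *)

(* Defs.v *)
From HB Require Import structures.
From mathcomp Require Import all_boot all_order all_algebra all_fingroup.
From mathcomp Require Import all_classical all_reals all_analysis.

Set Implicit Arguments.
Unset Strict Implicit.
Unset Printing Implicit Defensive.

Import Order.TTheory GRing.Theory Num.Theory.
Import numFieldNormedType.Exports.

Local Open Scope classical_set_scope.
Local Open Scope ring_scope.

Definition total_load n (x : 'I_n -> nat) : nat := (\sum_(j < n) x j)%N.

Definition normalized_load (R : realType) n (x : 'I_n -> nat) (i : 'I_n) : R :=
  (x i)%:R - (total_load x)%:R / n%:R.

Definition gap (R : realType) n (x : 'I_n -> nat) : R :=
  (\max_(j < n) x j)%N%:R - (total_load x)%:R / n%:R.

(* [s k] is the bin carrying label [k] (labels start at 0); ties between
   equally loaded bins may be broken in any way. *)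
Definition sorted_labeling (R : realType) n (x : 'I_n -> nat) (s : 'S_n) :=
  forall k l : 'I_n, (k <= l)%N ->
    normalized_load R x (s l) <= normalized_load R x (s k).

Definition distribution_vector (R : realType) n (p : 'I_n -> R) :=
  (forall k, 0 <= p k) /\ \sum_(k < n) p k = 1.

Definition majorized_by_uniform (R : realType) n (p : 'I_n -> R) :=
  forall k : nat, (1 <= k <= n)%N ->
    \sum_(j < n | (j < k)%N) p j <= k%:R / n%:R.

(* [a j] is the number of balls received by bin [j] in a round whose normalized
   loads are [y].  The exceptional bins [k1] and [k2] may be absent.  A bin with
   [y j >= 0] has [Num.ceil (- y j) - 1 < 0], so for such a bin the upper bound
   on [a j] can only mean that it receives no ball; hence the disjunct
   [a j = 0]. *)
Definition filling (R : realType) n (y : 'I_n -> R) (a : 'I_n -> nat) :=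
  exists k1 k2 : option 'I_n,
    [/\ forall j, k1 = Some j -> (a j)%:Z = Num.ceil (- y j) + 1,
        forall j, k2 = Some j -> (a j)%:Z = Num.ceil (- y j)
      & forall j, k1 <> Some j -> k2 <> Some j ->
          a j = 0%N \/ (a j)%:Z <= Num.ceil (- y j) - 1].

(* One round, from loads [x] to loads [x'], when bin [i] is sampled. *)
Definition W1_round (R : realType) n (x x' : 'I_n -> nat) (i : 'I_n) :=
  let y := normalized_load R x in
  exists a : 'I_n -> nat,
    [/\ forall j, x' j = (x j + a j)%N,
        y i < 0 -> (\sum_(j < n) a j)%N%:Z = Num.ceil (- y i) + 1 /\ filling y a
      & 0 <= y i -> forall j, a j = (j == i)].

Definition measurable_wrt_discrete T (G : set (set T)) V (f : T -> V) :=
  forall v, G (f @^-1` [set v]).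

Definition measurable_wrt_real (R : realType) T (G : set (set T)) (f : T -> R) :=
  forall B : set R, measurable B -> G (f @^-1` B).

(* [load X t] is the load vector after [t] rounds and [bin X t] is the bin
   sampled in the round leading from [load X t] to [load X t.+1].  [filt X t]
   is the information available after [t] rounds: it contains the history of
   loads and samples, and possibly further randomness used by the process. *)
Record allocation_process d (T : measurableType d) (n : nat) :=
  AllocationProcess {
    filt : nat -> set (set T);
    load : nat -> T -> 'I_n -> nat;
    bin : nat -> T -> 'I_n;
    filt_sigma_algebra : forall t, sigma_algebra [set: T] (filt t);
    filt_measurable : forall t, filt t `<=` measurable;
    filt_nondecreasing : forall s t, (s <= t)%N -> filt s `<=` filt t;
    load_adapted : forall t j,
      measurable_wrt_discrete (filt t) (fun w => load t w j);
    bin_adapted : forall t, measurable_wrt_discrete (filt t.+1) (bin t);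
    load0 : forall w j, load 0%N w j = 0%N
  }.

(* The last clause says that, conditionally on [filt X t], the bin with label
   [k] is sampled with probability [p _ k]. *)
Definition condition_P1 d (T : measurableType d) (R : realType)
    (P : probability T R) n (X : allocation_process T n) :=
  forall t, exists (s : T -> 'S_n) (p : T -> 'I_n -> R),
    [/\ measurable_wrt_discrete (filt X t) s,
        forall k, measurable_wrt_real (filt X t) (fun w => p w k),
        forall w, sorted_labeling R (load X t w) (s w),
        forall w, distribution_vector (p w) /\ majorized_by_uniform (p w)
      & forall (A : set T) (k : 'I_n), filt X t A ->
          P (A `&` [set w | bin X t w = s w k]) =
          (\int[P]_(w in A) (p w k)%:E)%E].

Definition condition_W1 d (T : measurableType d) (R : realType) n
    (X : allocation_process T n) :=
  forall t w, W1_round R (load X t w) (load X t.+1 w) (bin X t w).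

(* Main.v *)
Require Import Defs.
From HB Require Import structures.
From mathcomp Require Import all_boot all_order all_algebra all_fingroup.
From mathcomp Require Import all_classical all_reals all_analysis.
From mathcomp Require Import measurable_realfun zify ring lra.

Set Implicit Arguments.
Unset Strict Implicit.
Unset Printing Implicit Defensive.

Import Order.TTheory GRing.Theory Num.Theory.
Import numFieldNormedType.Exports.

Local Open Scope classical_set_scope.
Local Open Scope ring_scope.

(* Let Phi be the sum of exp(a y_j) over the overloaded bins (y_j >= 0), with a
   small constant a. Sampling an overloaded bin i changes Phi by about
   a exp(a y_i) - a Phi/n, and by majorization the gain is at most a Phi/n in
   expectation. Sampling an underloaded bin i multiplies Phi by about exp(-a b/n),
   where b >= 1 - y_i, and makes at most two bins overloaded, each with normalized
   load below 2. The first-order drift of Phi is thus -(a Phi/n) f, where f is the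
   expectation of b - 1 restricted to the sampling of an underloaded bin.

   The number f can be tiny, but only when the average load is just below an
   integer: if theta is the distance from the average up to the next integer, then
   every overloaded bin has y_j >= theta, so f >= theta/2. Since theta averages to
   1/2 while the total load W grows, a bounded factor exp(a h(W)), periodic in W
   and with h quadratic in theta, spreads the drift evenly. The corrected potential
   Psi = exp(a h(W)) Phi satisfies E[Psi'] <= (1 - c/n) E[Psi] + 16 in every round,
   hence E[Psi] = O(n) at all times, and Markov's inequality bounds the gap. *)

(** * Majorization by Abel summation, and elementary exponential bounds *)

Lemma abel_sum_ge (R : realType) (f g : nat -> R) n :
  (forall k, (k <= n.+1)%N -> 0 <= \sum_(j < k) f j) ->
  (forall k, (k < n)%N -> g k.+1 <= g k) ->
  (\sum_(j < n.+1) f j) * g n <= \sum_(j < n.+1) f j * g j.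
Proof.
elim: n => [|n IHn] f_ge0 g_dec; first by rewrite !big_ord1.
rewrite big_ord_recr [leRHS]big_ord_recr /= mulrDl lerD2r.
apply: le_trans (IHn _ _) => [|k kn|k kn]; last 2 first.
- by apply: f_ge0; exact: leqW.
- by apply: g_dec; exact: ltnW.
by apply: ler_wpM2l; [exact: f_ge0|exact: g_dec].
Qed.

(** Abel summation applies to the differences [1 / n - p k]: majorization makes their partial sums
    nonnegative, and their total is 0. *)
Lemma majorized_mean_le (R : realType) n (p G : 'I_n -> R) :
  distribution_vector p -> majorized_by_uniform p ->
  (forall k l : 'I_n, (k <= l)%N -> G l <= G k) ->
  \sum_(k < n) p k * G k <= (\sum_(k < n) G k) / n%:R.
Proof.
case: n => [|n] in p G * => -[p_ge0 p1] pmaj G_dec.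
  by rewrite !big_ord0 mul0r.
pose f j : R := n.+1%:R^-1 - p (inord j).
pose g j : R := G (inord j).
have n0 : n.+1%:R != 0 :> R by rewrite pnatr_eq0.
have fE k : (k <= n.+1)%N ->
    \sum_(j < k) f j = k%:R / n.+1%:R - \sum_(j < n.+1 | (j < k)%N) p j.
  move=> kn; rewrite sumrB sumr_const card_ord mulr_natl; congr (_ - _).
  rewrite (big_ord_widen _ (fun j => p (inord j)) kn).
  by apply: eq_bigr => j _; rewrite inord_val.
have f_tot : \sum_(j < n.+1) f j = 0.
  rewrite fE// divff// (eq_bigl xpredT) ?p1 ?subrr// => j.
  exact: ltn_ord.
have f_ge0 k : (k <= n.+1)%N -> 0 <= \sum_(j < k) f j.
  case: k => [|k] kn; first by rewrite big_ord0.
  by rewrite fE// subr_ge0; exact: pmaj.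
have g_dec k : (k < n)%N -> g k.+1 <= g k.
  by move=> kn; apply: G_dec; rewrite !inordK// ltnW// ltnS.
have := abel_sum_ge f_ge0 g_dec.
rewrite f_tot mul0r -subr_ge0 subr0 => h.
rewrite -subr_ge0; apply: le_trans h _.
rewrite mulr_suml -sumrB.
by apply: ler_sum => j _; rewrite /f /g inord_val mulrBl mulrC.
Qed.

(** The left side is at most [1 / (1 + z)], and [(1 + z) * (1 - z + z ^+ 2) = 1 + z ^+ 3]. *)
Lemma expRN_le (R : realType) (z : R) : 0 <= z -> expR (- z) <= 1 - z + z ^+ 2.
Proof.
move=> z0; rewrite expRN.
have z1 : 0 < 1 + z by lra.
apply: (@le_trans _ _ (1 + z)^-1).
  by rewrite lef_pV2 ?posrE ?expR_gt0// expR_ge1Dx.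
rewrite -(ler_pM2r z1) mulVf ?gt_eqF//.
have := exprn_ge0 3 z0; nra.
Qed.

(** The left side is at most [1 / (1 - z)], and [(1 - z) * (1 + z + 2 * z ^+ 2) = 1 + z ^+ 2 * (1 -
    2 * z)], which is at least 1 for [z <= 1 / 2]. *)
Lemma expR_le_quadratic (R : realType) (z : R) :
  0 <= z <= 2^-1 -> expR z <= 1 + z + 2 * z ^+ 2.
Proof.
move=> /andP[z0 z1]; rewrite -[z in leLHS]opprK expRN.
have z2 : 0 < 1 - z by lra.
apply: (@le_trans _ _ (1 - z)^-1).
  by rewrite lef_pV2 ?posrE ?expR_gt0// expR_ge1Dx.
rewrite -(ler_pM2r z2) mulVf ?gt_eqF//.
have := sqr_ge0 z; nra.
Qed.

(** * The periodic correction as a function of the total load *)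

Definition phase (R : realType) (n W : nat) : R :=
  ((W + n.-1) %% n)%:R / n%:R.

(* With [theta] the distance from the average load up to the next integer,
   [phase = 1 - 1/n - theta]. One extra ball changes [correction] by
   [(2 * theta - 1 + 1/n) / (16 * n)], a quantity that is negative exactly when
   the average is just below an integer (see [correctionS]). *)
Definition correction (R : realType) (n W : nat) : R :=
  phase R n W * (1 - phase R n W) / 16.

Section Correction.
Context (R : realType) (n : nat).
Hypothesis n_gt0 : (0 < n)%N.
Implicit Types W b : nat.

Let n_neq0 : n%:R != 0 :> R. Proof. by rewrite pnatr_eq0 -lt0n. Qed.

Lemma phase_ge0 W : 0 <= phase R n W.
Proof. exact: divr_ge0. Qed.

Lemma phase_le W : phase R n W <= 1 - n%:R^-1.
Proof.
rewrite ler_pdivrMr ?ltr0n// mulrBl mul1r mulVf//.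
by rewrite lerBrDr natr1 ler_nat ltn_pmod.
Qed.

(** A ball raises the phase by [1 / n], except that it wraps from [1 - 1 / n] to 0 instead of
    reaching 1. The formula survives the wrap because the quadratic takes the same value at 0 and at
    1. *)
Lemma correctionS W :
  correction R n W.+1 =
  correction R n W + (1 - 2 * phase R n W - n%:R^-1) / (16 * n%:R).
Proof.
rewrite /correction /phase addSn -[(W + n.-1).+1]addn1 -modnDml.
set u := ((W + n.-1) %% n)%N.
have : (u < n)%N by rewrite ltn_pmod.
rewrite leq_eqVlt => /predU1P[un|un].
  rewrite addn1 un modnn -[in n%:R]un -natr1.
  have : u.+1%:R != 0 :> R by rewrite pnatr_eq0.
  by rewrite -natr1 => h; field.
by rewrite modn_small ?addn1// -natr1; field.
Qed.

Lemma correction_ge0 W : 0 <= correction R n W.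
Proof.
have := phase_ge0 W; have := phase_le W.
have : 0 <= n%:R^-1 :> R by rewrite invr_ge0.
rewrite /correction; nra.
Qed.

Lemma correction_le W : correction R n W <= 16^-1.
Proof.
have := phase_ge0 W; have := phase_le W.
have : 0 <= n%:R^-1 :> R by rewrite invr_ge0.
rewrite /correction; nra.
Qed.

Lemma correctionD_le W b :
  correction R n (W + b) <= correction R n W + b%:R / (16 * n%:R).
Proof.
elim: b => [|b IHb]; first by rewrite addn0 mul0r addr0.
rewrite addnS correctionS.
have step : (1 - 2 * phase R n (W + b) - n%:R^-1) / (16 * n%:R)
    <= 1 / (16 * n%:R).
  rewrite ler_wpM2r ?invr_ge0 ?mulr_ge0//.
  have := phase_ge0 (W + b).
  have : 0 <= n%:R^-1 :> R by rewrite invr_ge0.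
  lra.
by apply: le_trans (lerD IHb step) _; rewrite -addrA -mulrDl natr1.
Qed.

End Correction.

(** * Change of the potential in a single round *)

Definition rate (R : realType) : R := 192^-1.

Definition overload_potential (R : realType) n (x : 'I_n -> nat) : R :=
  \sum_(j < n | 0 <= normalized_load R x j)
    expR (rate R * normalized_load R x j).

Definition potential (R : realType) n (x : 'I_n -> nat) : R :=
  expR (rate R * correction R n (total_load x)) * overload_potential R x.

Section Round.
Context (R : realType) (n : nat).
Implicit Types (x a : 'I_n -> nat) (i j k : 'I_n).

Lemma rate_gt0 : 0 < rate R.
Proof. by rewrite invr_gt0. Qed.

Lemma total_loadD x x' a :
  (forall j, x' j = (x j + a j)%N) ->
  total_load x' = (total_load x + total_load a)%N.
Proof.
by move=> x'E; rewrite /total_load -big_split; apply: eq_bigr => j _; rewrite x'E.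
Qed.

Lemma normalized_loadD x x' a j :
  (forall j, x' j = (x j + a j)%N) ->
  normalized_load R x' j =
  normalized_load R x j + (a j)%:R - (total_load a)%:R / n%:R.
Proof.
move=> x'E; rewrite /normalized_load (total_loadD x'E) x'E !natrD mulrDl.
ring.
Qed.

Lemma overload_potential_ge0 x : 0 <= overload_potential R x.
Proof. by apply: sumr_ge0 => j _; exact: expR_ge0. Qed.

(** The ball lowers every other normalized load by [1 / n], so no other bin enters the sum, and a
    bin that leaves it only decreases the potential. *)
Lemma overloaded_round x x' a i :
  0 <= normalized_load R x i ->
  (forall j, x' j = (x j + a j)%N) -> (forall j, a j = (j == i)) ->
  overload_potential R x' <=
  expR (- (rate R / n%:R)) *
  (overload_potential R x
   + (expR (rate R) - 1) * expR (rate R * normalized_load R x i)).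
Proof.
move=> yi x'E aE; have a1 : total_load a = 1%N.
  rewrite /total_load (bigD1 i)//= aE eqxx big1 ?addn0// => j /negPf ji.
  by rewrite aE ji.
have -> : (expR (rate R) - 1) * expR (rate R * normalized_load R x i) =
    \sum_j (if j == i then
        (expR (rate R) - 1) * expR (rate R * normalized_load R x i) else 0).
  by rewrite -big_mkcond big_pred1_eq.
rewrite /overload_potential !(big_mkcond (fun j => 0 <= _)) -big_split mulr_sumr.
apply: ler_sum => j _ /=; rewrite (normalized_loadD j x'E) a1 aE.
have e1 : 1 <= expR (rate R) by rewrite -expR0 ler_expR ltW// rate_gt0.
have [->|ji] := eqVneq j i => /=.
  rewrite yi [leRHS](_ : _ = expR (- (rate R / n%:R)) *
    (expR (rate R) * expR (rate R * normalized_load R x i))); last by ring.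
  rewrite -!expRD; case: ifPn => _; last exact: expR_ge0.
  by rewrite ler_expR le_eqVlt; apply/orP; left; apply/eqP; ring.
rewrite !addr0 (_ : _ - _ = normalized_load R x j - n%:R^-1); last by rewrite div1r.
have n0 : 0 <= n%:R^-1 :> R by rewrite invr_ge0.
case: ifPn => y0.
  rewrite ifT; last by move: y0 n0; lra.
  rewrite -expRD ler_expR le_eqVlt; apply/orP; left; apply/eqP; ring.
by apply: mulr_ge0; [exact: expR_ge0|case: ifP => _ //; exact: expR_ge0].
Qed.

Lemma sum_option_pred_le (k : option 'I_n) (c : R) : 0 <= c ->
  \sum_j (if k == Some j then c else 0) <= c.
Proof.
move=> c0; case: k => [k|]; last by rewrite big1.
rewrite (bigD1 k)//= eqxx big1 ?addr0// => j jk.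
by rewrite ifF//; apply/eqP => -[kj]; rewrite kj eqxx in jk.
Qed.

(** A bin other than [k1] and [k2] that receives balls stays below the average, because
    [y + Num.ceil (- y) - 1 < 0]. Only [k1] and [k2] can thus enter the sum, each with normalized
    load below 2. *)
Lemma underloaded_round x x' a :
  (forall j, x' j = (x j + a j)%N) -> filling (normalized_load R x) a ->
  overload_potential R x' <=
  expR (- (rate R * (total_load a)%:R / n%:R)) * overload_potential R x
  + 2 * expR (2 * rate R).
Proof.
move=> x'E [k1 [k2 [a1 a2 a3]]].
have e0 := expR_ge0 (2 * rate R).
apply: (@le_trans _ _ (
    expR (- (rate R * (total_load a)%:R / n%:R)) * overload_potential R x
    + (\sum_j (if k1 == Some j then expR (2 * rate R) else 0)
       + \sum_j (if k2 == Some j then expR (2 * rate R) else 0)))); last first.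
  rewrite lerD2l; have := sum_option_pred_le k1 e0.
  by have := sum_option_pred_le k2 e0; lra.
rewrite /overload_potential !(big_mkcond (fun j => 0 <= _)) mulr_sumr -!big_split.
apply: ler_sum => j _ /=; rewrite (normalized_loadD j x'E).
set y := normalized_load R x j.
set b : R := (total_load a)%:R / n%:R; rewrite -mulrA -/b.
have b0 : 0 <= b by exact: divr_ge0.
have r0 := rate_gt0.
have yceil : (Num.ceil (- y))%:~R < - y + 1.
  by have := ceilB1_lt (- y); rewrite intrB; lra.
have m0 : 0 <= expR (- (rate R * b)) * (if 0 <= y then expR (rate R * y) else 0).
  by apply: mulr_ge0; [exact: expR_ge0|case: ifP => _ //; exact: expR_ge0].
have ge0 (k : option 'I_n) : 0 <= (if k == Some j then expR (2 * rate R) else 0).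
  by case: ifP.
have aR : (a j)%:R = ((a j)%:Z)%:~R :> R by [].
have [k1j|k1j] := eqVneq k1 (Some j) => /=.
  have : (if 0 <= y + (a j)%:R - b
      then expR (rate R * (y + (a j)%:R - b)) else 0) <= expR (2 * rate R).
    case: ifP => // _; rewrite ler_expR aR (a1 _ k1j) intrD mulrC ler_wpM2r ?ltW//.
    by move: yceil b0; lra.
  by move=> h; apply: le_trans h _; rewrite addrCA lerDl addr_ge0.
have [k2j|k2j] := eqVneq k2 (Some j) => /=.
  have : (if 0 <= y + (a j)%:R - b
      then expR (rate R * (y + (a j)%:R - b)) else 0) <= expR (2 * rate R).
    case: ifP => // _; rewrite ler_expR aR (a2 _ k2j) mulrC ler_wpM2r ?ltW//.
    by move: yceil b0; lra.
  by move=> h; apply: le_trans h _; rewrite add0r lerDr.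
rewrite !addr0; have [aj0|aj] : a j = 0%N \/ (a j)%:Z <= Num.ceil (- y) - 1.
    by apply: a3; apply/eqP.
  rewrite aj0 addr0; case: ifPn => // yb.
  rewrite ifT; last by move: yb b0; lra.
  by rewrite -expRD ler_expR le_eqVlt; apply/orP; left; apply/eqP; ring.
rewrite ifF//; apply/negbTE; rewrite -ltNge.
move: aj; rewrite -(ler_int R) intrB -aR; move: yceil b0; lra.
Qed.

End Round.

(* A lower bound for the number of balls, minus one, placed after sampling the
   underloaded bin [i]. The truncation at [n] keeps the exponent
   [rate * (1 + deficit) / n] small, so that the exponential can be linearized. *)
Definition deficit (R : realType) n (x : 'I_n -> nat) (i : 'I_n) : R :=
  Num.max 1 (Num.min (- normalized_load R x i) n%:R).

(** This is [n] times the increment of [correction] caused by one ball. *)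
Definition slope (R : realType) n (x : 'I_n -> nat) : R :=
  (1 - 2 * phase R n (total_load x) - n%:R^-1) / 16.

(** A ball given to an overloaded bin multiplies the potential by at most [expR (- shrink)], apart
    from the gain of that bin. The exponent combines the growth of the average with the change of
    the correction. *)
Definition shrink (R : realType) n (x : 'I_n -> nat) : R :=
  rate R * n%:R^-1 * (1 - slope R x).

(** This linearized bound depends only on the loads before the round and on the sampled bin, not on
    where the balls go, so it can be averaged over the sampling distribution. *)
Definition round_bound (R : realType) n (x : 'I_n -> nat) (i : 'I_n) : R :=
  expR (rate R * correction R n (total_load x)) *
  if 0 <= normalized_load R x i then
    (1 - shrink R x + shrink R x ^+ 2) * overload_potential R x
    + (rate R + 2 * rate R ^+ 2) * expR (rate R * normalized_load R x i)
  else
    (1 - 9 / 10 * rate R * n%:R^-1 * (1 + deficit R x i))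
    * overload_potential R x + 8.

Section RoundBound.
Context (R : realType) (n : nat).
Hypothesis n_gt0 : (0 < n)%N.
Implicit Types (x a : 'I_n -> nat) (i j k : 'I_n).

Lemma slope_itv x : `|slope R x| <= 16^-1.
Proof.
have := phase_ge0 R n (total_load x); have := phase_le R n_gt0 (total_load x).
have : 0 <= n%:R^-1 :> R by rewrite invr_ge0.
by rewrite ler_norml /slope; lra.
Qed.

Lemma shrink_itv x :
  0 <= shrink R x <= 17 / 16 * rate R * n%:R^-1.
Proof.
have n0 : 0 <= n%:R^-1 :> R by rewrite invr_ge0.
have := slope_itv x; rewrite ler_norml => /andP[s1 s2].
have an : 0 <= rate R * n%:R^-1 by rewrite mulr_ge0// ltW// rate_gt0.
by apply/andP; split; rewrite /shrink; nra.
Qed.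

Lemma deficit_itv x i : 1 <= deficit R x i <= n%:R.
Proof.
have n1 : 1 <= n%:R :> R by rewrite ler1n.
by rewrite /deficit le_max lexx/= ge_max n1 ge_min lexx orbT.
Qed.

Lemma potential_overloaded_round x x' i :
  0 <= normalized_load R x i -> W1_round R x x' i ->
  potential R x' <= round_bound R x i.
Proof.
move=> yi [a [x'E _ /(_ yi) aE]]; rewrite /round_bound yi.
have := overloaded_round yi x'E aE.
have -> : potential R x' = expR (rate R * correction R n (total_load x)) *
    (expR (rate R * slope R x / n%:R) * overload_potential R x').
  rewrite mulrA -expRD /potential (total_loadD x'E) (_ : total_load a = 1%N).
    rewrite addn1 correctionS//; congr (expR _ * _).
    by rewrite /slope invfM; ring.
  rewrite /total_load (bigD1 i)//= aE eqxx big1 ?addn0// => j /negPf ji.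
  by rewrite aE ji.
set E := overload_potential R x; set f := expR (rate R * _) => h.
have E0 : 0 <= E by exact: overload_potential_ge0.
have f0 : 0 <= f by exact: expR_ge0.
rewrite ler_pM2l ?expR_gt0//.
have /andP[z0 _] := shrink_itv x.
apply: (@le_trans _ _ (expR (- shrink R x) * (E + (expR (rate R) - 1) * f))).
  have -> : - shrink R x = rate R * slope R x / n%:R + (- (rate R / n%:R)).
    by rewrite /shrink; ring.
  by rewrite expRD -[leRHS]mulrA ler_pM2l ?expR_gt0.
rewrite mulrDr lerD//; first by rewrite ler_wpM2r// expRN_le.
have r0 := rate_gt0 R.
have e1 : 1 <= expR (rate R) by rewrite -expR0 ler_expR ltW.
rewrite mulrA ler_wpM2r//.
apply: (@le_trans _ _ (1 * (expR (rate R) - 1))).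
  rewrite ler_wpM2r ?subr_ge0//.
  by rewrite -expR0 ler_expR oppr_le0.
have : 0 <= rate R <= 2^-1 by rewrite ltW//= /rate; lra.
by move=> /expR_le_quadratic; lra.
Qed.

Lemma potential_underloaded_round x x' i :
  normalized_load R x i < 0 -> W1_round R x x' i ->
  potential R x' <= round_bound R x i.
Proof.
move=> yi [a [x'E /(_ yi) [ab fill] _]]; rewrite /round_bound (leNgt 0) yi/=.
have r0 := rate_gt0 R.
have n0 : 0 < n%:R^-1 :> R by rewrite invr_gt0 ltr0n.
have := underloaded_round x'E fill.
rewrite /potential (total_loadD x'E).
set W := total_load x; set E := overload_potential R x.
have E0 : 0 <= E by exact: overload_potential_ge0.
set b : R := (total_load a)%:R; rewrite -mulrA => h.
have bE : b = (Num.ceil (- normalized_load R x i))%:~R + 1.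
  by rewrite /b -[(_)%:R]/((total_load a)%:Z%:~R) ab intrD.
have /andP[d1 dn] := deficit_itv x i.
have bd : 1 + deficit R x i <= b.
  rewrite bE addrC lerD2r /deficit ge_max; apply/andP; split.
    by rewrite -[1]/(1%:~R) ler_int -gtz0_ge1 ceil_gt0 oppr_gt0.
  by rewrite ge_min ceil_ge.
(* The average grows by [b / n], and the correction gives back at most 1/16 of the resulting decay.
   As [w <= 1 / 100], the quadratic term costs at most [w / 25], whence the factor
   [24 / 25 * 15 / 16 = 9 / 10]. *)
set w := 15 / 16 * rate R * n%:R^-1 * (1 + deficit R x i).
have rn0 : 0 < rate R * n%:R^-1 by exact: mulr_gt0.
have w0 : 0 <= w by rewrite /w -!mulrA; apply: mulr_ge0; nra.
have w1 : w <= 100^-1.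
  have : n%:R^-1 * (1 + deficit R x i) <= 2.
    by rewrite mulrC ler_pdivrMr ?ltr0n//; lra.
  by rewrite /w /rate; lra.
have corr_le : expR (rate R * correction R n (W + total_load a)) <=
    expR (rate R * correction R n W) * expR (rate R * (b / (16 * n%:R))).
  by rewrite -expRD ler_expR -mulrDr ler_pM2l// correctionD_le.
have corr_le2 : expR (rate R * correction R n (W + total_load a)) <=
    expR (rate R / 16).
  by rewrite ler_expR ler_pM2l// correction_le.
have corr_ge1 : 1 <= expR (rate R * correction R n W).
  by rewrite -expR0 ler_expR mulr_ge0 ?correction_ge0// ltW.
apply: le_trans (ler_wpM2l (expR_ge0 _) h) _.
rewrite [leLHS]mulrDr [leRHS]mulrDr lerD//.
  rewrite [leLHS]mulrA [leRHS]mulrA ler_wpM2r//.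
  apply: le_trans (ler_wpM2r (expR_ge0 _) corr_le) _.
  rewrite -[leLHS]mulrA ler_wpM2l ?expR_ge0// -expRD.
  apply: (@le_trans _ _ (expR (- w))).
    rewrite ler_expR (_ : _ + _ = - (15 / 16 * rate R * n%:R^-1 * b)).
      by rewrite lerN2 /w ler_wpM2l// -mulrA mulr_ge0// ltW.
    by field; rewrite pnatr_eq0 -lt0n.
  apply: le_trans (expRN_le w0) _.
  have -> : 9 / 10 * rate R * n%:R^-1 * (1 + deficit R x i) = 24 / 25 * w.
    by rewrite /w; field; rewrite pnatr_eq0 -lt0n.
  by nra.
apply: (@le_trans _ _ (1 * 8)); last by rewrite ler_wpM2r.
apply: (@le_trans _ _ (expR (rate R / 16) * (2 * expR (2 * rate R)))).
  by rewrite ler_wpM2r// mulr_ge0// expR_ge0.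
rewrite mulrCA -expRD.
have : expR (rate R / 16 + 2 * rate R) <= expR 2^-1.
  by rewrite ler_expR /rate; lra.
have := @expR_le_quadratic R 2^-1; rewrite lexx invr_ge0 ler0n => /(_ erefl).
lra.
Qed.

Lemma potential_round x x' i :
  W1_round R x x' i -> potential R x' <= round_bound R x i.
Proof.
have [yi|yi] := leP 0 (normalized_load R x i).
  exact: potential_overloaded_round.
exact: potential_underloaded_round.
Qed.

End RoundBound.

Lemma expR_correction_le2 (R : realType) n W : (0 < n)%N ->
  expR (rate R * correction R n W) <= 2.
Proof.
move=> n0; apply: (@le_trans _ _ (expR 2^-1)).
  rewrite ler_expR /rate; have := correction_ge0 R n0 W.
  by have := correction_le R n0 W; lra.
have := @expR_le_quadratic R 2^-1.
by rewrite lexx invr_ge0 ler0n => /(_ erefl); lra.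
Qed.

(** * Expected drift for fixed loads and a fixed sampling distribution *)

Section Drift.
Context (R : realType) (n : nat) (x : 'I_n -> nat).
Hypothesis n_gt1 : (1 < n)%N.
Implicit Types (i j k : 'I_n).

Let n_gt0 : (0 < n)%N. Proof. exact: ltnW. Qed.
Let nR_gt0 : 0 < n%:R :> R. Proof. by rewrite ltr0n. Qed.

Lemma sum_normalized_load : \sum_j normalized_load R x j = 0.
Proof.
rewrite sumrB sumr_const card_ord -natr_sum -[_ *+ n]mulr_natr.
by rewrite divfK ?subrr// gt_eqF.
Qed.

(* The left-hand side is the distance from the average load up to the next
   integer, and loads are integers. *)
Lemma overloaded_ge j : 0 <= normalized_load R x j ->
  1 - n%:R^-1 - phase R n (total_load x) <= normalized_load R x j.
Proof.
rewrite /normalized_load /phase; set W := total_load x.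
rewrite subr_ge0 ler_pdivrMr// -natrM ler_nat => Wx.
have : ((n.-1 - (W + n.-1) %% n) + W <= x j * n)%N.
  have := divn_eq (W + n.-1) n; set q := (_ %/ n)%N; set u := (_ %% n)%N => e.
  have un : (u < n)%N by rewrite ltn_pmod.
  (* By the offset [n.-1], [q] is the ceiling of [W / n], and an integer that is at least [W / n] is
     at least [q]. *)
  have qx : (q <= x j)%N.
    rewrite leqNgt; apply/negP => xq.
    have : (x j * n + n <= q * n)%N by rewrite -mulSnr leq_mul2r xq orbT.
    by lia.
  have : (q * n <= x j * n)%N by rewrite leq_mul2r qx orbT.
  by lia.
rewrite -(ler_nat R) natrD natrB; last by rewrite -ltnS prednK// ltn_pmod.
rewrite natrM -subn1 natrB// => h.
rewrite -(ler_pM2r nR_gt0) !mulrBl !mulfVK ?gt_eqF// mul1r mulVf ?gt_eqF//.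
by move: h; lra.
Qed.

Variables (s : 'S_n) (p : 'I_n -> R).
Hypothesis x_sorted : sorted_labeling R x s.
Hypothesis p_distr : distribution_vector p.
Hypothesis p_maj : majorized_by_uniform p.

Let o (k : 'I_n) := 0 <= normalized_load R x (s k).

Let o_dec (k l : 'I_n) : (k <= l)%N -> o l -> o k.
Proof. by move=> kl ol; apply: le_trans ol (x_sorted kl). Qed.

Let E := overload_potential R x.
Let U := \sum_k p k * (if o k then 0 else 1).
Let V := \sum_k p k * (if o k then 1 else 0).
Let S := \sum_k p k *
  (if o k then expR (rate R * normalized_load R x (s k)) else 0).
Let D := \sum_k p k * (if o k then 0 else deficit R x (s k)).

Let S_le : S <= E / n%:R.
Proof.
apply: le_trans (majorized_mean_le p_distr p_maj _) _.
  move=> k l kl; have [ol|ol] := boolP (o l).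
    rewrite (o_dec kl ol) ler_expR ler_wpM2l//.
      by rewrite ltW// rate_gt0.
    exact: x_sorted.
  by case: ifP => // _; exact: expR_ge0.
rewrite le_eqVlt; apply/orP; left; apply/eqP; congr (_ / _).
rewrite /E /overload_potential [RHS](reindex_inj (@perm_inj _ s)).
by rewrite [RHS]big_mkcond.
Qed.

Let UV : U = 1 - V.
Proof.
rewrite -p_distr.2 /U /V -sumrB; apply: eq_bigr => k _.
by case: (o k); ring.
Qed.

Let V_ge0 : 0 <= V.
Proof.
apply: sumr_ge0 => k _; apply: mulr_ge0; first exact: p_distr.1.
by case: (o k).
Qed.

Let U_ge0 : 0 <= U.
Proof.
apply: sumr_ge0 => k _; apply: mulr_ge0; first exact: p_distr.1.
by case: (o k).
Qed.

Let D_ge_U : U <= D.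
Proof.
apply: ler_sum => k _; apply: ler_wpM2l; first exact: p_distr.1.
case: (o k) => //.
by have /andP[] := deficit_itv R n_gt0 x (s k).
Qed.

Let theta := 1 - n%:R^-1 - phase R n (total_load x).

Let theta_ge0 : 0 <= theta.
Proof. by have := phase_le R n_gt0 (total_load x); rewrite /theta; lra. Qed.

Let theta_le1 : theta <= 1 - n%:R^-1.
Proof. by have := phase_ge0 R n (total_load x); rewrite /theta; lra. Qed.

Let count_overloaded := \sum_(k < n) (if o k then 1 else 0) : R.

Let V_le : V <= count_overloaded / n%:R.
Proof.
apply: majorized_mean_le => // k l kl.
have [/(o_dec kl)->//|_] := boolP (o l).
by case: ifP.
Qed.

(** Normalized loads sum to zero, so the total underload equals the total overload, to which each
    overloaded bin contributes at least [theta]. *)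
Let sum_overloaded :
  count_overloaded * theta <=
  \sum_k (if o k then 0 else - normalized_load R x (s k)).
Proof.
have -> : \sum_k (if o k then 0 else - normalized_load R x (s k)) =
    \sum_k (if o k then normalized_load R x (s k) else 0).
  apply/eqP; rewrite -subr_eq0 -sumrB -oppr_eq0 -sumrN; apply/eqP.
  rewrite -[RHS]sum_normalized_load [RHS](reindex_inj (@perm_inj _ s)).
  by apply: eq_bigr => k _ /=; case: (o k); ring.
rewrite mulr_suml; apply: ler_sum => k _.
case: ifPn => ok; last by rewrite mul0r.
by rewrite mul1r; exact: overloaded_ge.
Qed.

(** The truncated deficits [g] increase with the label, so majorization bounds their expectation
    from below by their uniform mean. If the truncation is active at some bin, that bin alone
    contributes [n], which suffices by hypothesis; otherwise [sum_overloaded] applies. *)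
Let D_ge : count_overloaded * theta <= n%:R ->
  count_overloaded * theta / n%:R <= D.
Proof.
move=> cn.
pose g k := if o k then 0 else Num.min (- normalized_load R x (s k)) n%:R.
have g_ge0 k : 0 <= g k.
  rewrite /g; case: ifPn => // ok; rewrite le_min ler0n andbT oppr_ge0.
  by rewrite ltW// ltNge.
apply: (@le_trans _ _ (\sum_k p k * g k)); last first.
  apply: ler_sum => k _; apply: ler_wpM2l; first exact: p_distr.1.
  by rewrite /g; case: (o k) => //; rewrite le_max lexx orbT.
apply: (@le_trans _ _ ((\sum_k g k) / n%:R)); last first.
  have := @majorized_mean_le R n p (fun k => - g k) p_distr p_maj.
  rewrite sumrN mulNr; under eq_bigr do rewrite mulrN.
  rewrite sumrN lerN2; apply => k l kl; rewrite lerN2 /g.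
  have [ol|ol] := boolP (o l); first by rewrite (o_dec kl ol).
  case: ifPn => ok; first by have := g_ge0 l; rewrite /g (negbTE ol).
  by rewrite le_min !ge_min lexx orbT andbT lerN2 (x_sorted kl).
rewrite ler_wpM2r ?invr_ge0//.
have [[k /andP[ok kn]]|none] := pselect (exists k,
    ~~ o k && (n%:R < - normalized_load R x (s k))).
  have gk : g k = n%:R by rewrite /g (negbTE ok) min_r// ltW.
  by apply: le_trans cn _; rewrite (bigD1 k)//= gk lerDl sumr_ge0.
apply: le_trans sum_overloaded _.
apply: ler_sum => k _; rewrite /g; case: ifPn => // ok.
rewrite min_l// leNgt; apply/negP => kn; apply: none; exists k.
by rewrite ok.
Qed.

(* First-order drift of the potential, in units of [- rate / n]. Either half of
   the bins are underloaded, or the underloaded bins have total deficit at least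
   [n * theta / 2] since the normalized loads sum to zero. *)
Let key : 32^-1 <=
  (1 - U) * (1 - slope R x) - 1 + 9 / 10 * (U + D).
Proof.
have n2 : n%:R^-1 <= 2^-1 :> R.
  by rewrite lef_pV2 ?posrE// ler_nat.
have n0 : 0 < n%:R^-1 :> R by rewrite invr_gt0.
have sE : slope R x = theta / 8 - 16^-1 + n%:R^-1 / 16.
  by rewrite /slope /theta; field; rewrite gt_eqF.
have U1 : U <= 1 by rewrite UV lerBlDr lerDl.
have s1 : slope R x <= 16^-1.
  by have := slope_itv R n_gt0 x; rewrite ler_norml => /andP[].
have s2 : - 16^-1 <= slope R x.
  by have := slope_itv R n_gt0 x; rewrite ler_norml => /andP[].
have U0 := U_ge0; have DU := D_ge_U; have t0 := theta_ge0; have t1 := theta_le1.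
have [cn|cn] := leP count_overloaded (n%:R / 2).
  have : V <= 2^-1.
    by apply: le_trans V_le _; rewrite ler_pdivrMr// mulrC.
  have UV' := UV; move: (U) (D) (V) (slope R x) UV' U0 DU U1 s1 s2.
  by move=> u d v sl; nra.
have D2 : theta / 2 <= D.
  have cn2 : count_overloaded <= n%:R.
    rewrite -[n in n%:R]card_ord -sumr_const; apply: ler_sum => k _.
    by case: (o k).
  have n00 := nR_gt0.
  move: (D_ge); move: (count_overloaded) cn cn2 => c cn cn2 Dge.
  apply: le_trans (Dge _).
    by rewrite ler_pdivlMr//; nra.
  by nra.
move: (U) (D) (slope R x) U0 DU U1 s1 s2 sE D2 => u d sl.
move: (theta) t0 t1 n2 n0 => th t0 t1 n2 n0 U0 DU U1 s1 s2 sE D2.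
(* As [n >= 2], [- sl] is at least [1 / 32 - th / 8]. The loss [th / 8] and the terms in [u] are
   paid by [d], which is at least both [th / 2] and [u]. *)
have : 0 <= u * (sl + 16^-1) by apply: mulr_ge0; lra.
by nra.
Qed.

Lemma sum_round_bound_le :
  \sum_k p k * round_bound R x (s k) <=
  (1 - rate R / (64 * n%:R)) * potential R x + 16.
Proof.
set z := shrink R x; set c := 9 / 10 * rate R * n%:R^-1.
set H := expR (rate R * correction R n (total_load x)).
have -> : \sum_k p k * round_bound R x (s k) =
    H * ((1 - z + z ^+ 2) * E * V + (rate R + 2 * rate R ^+ 2) * S
         + (E * U - c * E * U - c * E * D + 8 * U)).
  rewrite /U /V /S /D /round_bound -/H -/E -/z -/c; move: (E) => e.
  rewrite !mulr_sumr -!sumrB -!big_split/= mulr_sumr.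
  apply: eq_bigr => k _; rewrite -/(o k).
  by case: (o k); ring.
have H1 : 1 <= H.
  by rewrite -expR0 ler_expR mulr_ge0 ?correction_ge0// ltW// rate_gt0.
have H2 : H <= 2 by exact: expR_correction_le2.
have E0 : 0 <= E by exact: overload_potential_ge0.
have U1 : U <= 1 by rewrite UV lerBlDr lerDl.
suff main : (1 - z + z ^+ 2) * E * V + (rate R + 2 * rate R ^+ 2) * S
    + (E * U - c * E * U - c * E * D) <= (1 - rate R / (64 * n%:R)) * E.
  rewrite /potential -/H -/E.
  have := ler_wpM2l (le_trans ler01 H1) main.
  by move: (U) U1 U_ge0 => u u1 u0; nra.
have r0 := rate_gt0 R.
have n2 : n%:R^-1 <= 2^-1 :> R by rewrite lef_pV2 ?posrE// ler_nat.
have n0 : 0 < n%:R^-1 :> R by rewrite invr_gt0.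
set w := rate R * n%:R^-1.
have w0 : 0 < w by exact: mulr_gt0.
have w1 : w <= rate R / 2 by rewrite ler_pM2l.
have zE : z = w * (1 - slope R x) by [].
have zw : z ^+ 2 <= rate R * w.
  have /andP[z0 z1] := shrink_itv R n_gt0 x.
  rewrite -/z in z0 z1.
  have z1' : z <= 17 / 16 * w by rewrite /w mulrA.
  apply: (@le_trans _ _ ((17 / 16 * w) ^+ 2)).
    by rewrite ler_sqr ?nnegrE// mulr_ge0// ltW.
  by nra.
have S1 : (rate R + 2 * rate R ^+ 2) * S <= w * (1 + 2 * rate R) * E.
  apply: le_trans (ler_wpM2l _ S_le) _; first by nra.
  by rewrite /w le_eqVlt; apply/orP; left; apply/eqP; ring.
have coeff : (1 - z + z ^+ 2) * V + w * (1 + 2 * rate R)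
    + (U - 9 / 10 * w * (U + D)) <= 1 - w / 64.
  have Vz : V * z ^+ 2 <= rate R * w.
    have V1 : V <= 1 by move: UV U_ge0; lra.
    apply: le_trans zw; rewrite -[leRHS]mul1r.
    by apply: ler_wpM2r => //; exact: sqr_ge0.
  (* The choice of [rate] makes [1 / 32] equal to [6 * rate]. The quadratic terms cost
     [3 * rate * w], one part from [z ^+ 2] and two from [S], which leaves
     [3 * rate * w = w / 64]. *)
  have k6 : w * (6 * rate R) <=
      w * ((1 - U) * (1 - slope R x) - 1 + 9 / 10 * (U + D)).
    by rewrite ler_pM2l//; apply: le_trans key; rewrite /rate; lra.
  have VE : V = 1 - U by rewrite UV; ring.
  have wr : w * rate R = w / 192 by [].
  move: Vz k6; rewrite zE VE; move: wr; lra.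
have := ler_wpM2r E0 coeff.
have -> : rate R / (64 * n%:R) = w / 64.
  by rewrite /w; field; rewrite gt_eqF.
have -> : c = 9 / 10 * w by rewrite /c /w mulrA.
move: S1; move: (E) (S) (U) (V) (D) (w) => e f u v d b.
by move: (1 - z + z ^+ 2) => a; lra.
Qed.
End Drift.

(** * Boundedness of the loads and measurability of load events *)

Lemma W1_round_bounded (R : realType) n (x x' : 'I_n -> nat) i B :
  W1_round R x x' i -> (forall j, (x j <= B)%N) ->
  forall j, (x' j <= B + B.+1)%N.
Proof.
move=> [a [x'E aU aO]] xB j; rewrite x'E leq_add//.
have n0 : (0 < n)%N by case: n i {x x' a x'E aU aO xB j} => // -[].
have [yi|yi] := leP 0 (normalized_load R x i).
  by rewrite aO//; case: eqP.
have [ab _] := aU yi.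
apply: (@leq_trans (\sum_j a j)); first by rewrite (bigD1 j)//= leq_addr.
rewrite -lez_nat ab -addn1 PoszD lerD2r ceil_le_int.
apply: (@le_trans _ _ ((total_load x)%:R / n%:R)).
  by rewrite /normalized_load opprB lerBlDr lerDl.
rewrite ler_pdivrMr ?ltr0n// -[B%:~R]/(B%:R) -natrM ler_nat.
rewrite -[n in leqRHS]card_ord mulnC -sum_nat_const.
exact: leq_sum.
Qed.

Lemma W1_round_le (R : realType) n (x x' : 'I_n -> nat) i j :
  W1_round R x x' i -> (x j <= x' j)%N.
Proof. by move=> [a [-> _ _]]; exact: leq_addr. Qed.

(** A bound uniform over all outcomes makes the load vector finitely valued, so that expectations
    become finite sums. *)
Lemma load_bounded d (T : measurableType d) (R : realType) n
    (X : allocation_process T n) :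
  condition_W1 R X -> forall t, exists B, forall w j, (load X t w j <= B)%N.
Proof.
move=> XW; elim=> [|t [B loadB]]; first by exists 0%N => w j; rewrite load0.
exists (B + B.+1)%N => w.
exact: W1_round_bounded (XW t w) (loadB w).
Qed.

Lemma load_le d (T : measurableType d) (R : realType) n
    (X : allocation_process T n) :
  condition_W1 R X -> forall t u w j, (t <= u)%N ->
  (load X t w j <= load X u w j)%N.
Proof.
move=> XW t u w j /subnKC<-; elim: (u - t)%N => [|k IHk]; first by rewrite addn0.
by rewrite addnS; apply: leq_trans IHk _; exact: W1_round_le (XW _ w).
Qed.

Section Filtration.
Context d (T : measurableType d) n (X : allocation_process T n).
Implicit Types (A B : set T) (t : nat).

Lemma filtC t A : filt X t A -> filt X t (~` A).
Proof. by have [_ sC _] := filt_sigma_algebra X t; rewrite -setTD; exact: sC. Qed.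

Lemma filtI t A B : filt X t A -> filt X t B -> filt X t (A `&` B).
Proof.
have [s0 _ sU] := filt_sigma_algebra X t => tA tB.
rewrite -[A `&` B]setCK setCI; apply: filtC; rewrite -bigcup2E; apply: sU.
by move=> [|[|i]]; rewrite /bigcup2/=; [exact: filtC|exact: filtC|].
Qed.

Lemma filt_load t (x : 'I_n -> nat) : filt X t [set w | load X t w = x].
Proof.
suff loads (s : seq 'I_n) : filt X t [set w | {in s, forall j, load X t w j = x j}].
  rewrite (_ : [set _ | _] =
    [set w | {in enum 'I_n, forall j, load X t w j = x j}])//.
  apply/seteqP; split => [w /= <- //|w /= wx].
  by apply/funext => j; apply: wx; rewrite mem_enum.
elim: s => [|j s IHs].
  rewrite (_ : [set _ | _] = ~` set0); last by apply/seteqP; split=> w //= _ [].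
  by apply: filtC; have [] := filt_sigma_algebra X t.
rewrite (_ : [set _ | _] = (load X t)^~ j @^-1` [set x j] `&`
    [set w | {in s, forall j, load X t w j = x j}]).
  by apply: filtI IHs; exact: load_adapted.
apply/seteqP; split => w /=.
  move=> h; split; first by apply: h; rewrite inE eqxx.
  by move=> k ks; apply: h; rewrite inE ks orbT.
by move=> [hj hs] k; rewrite inE => /predU1P[->//|]; exact: hs.
Qed.

End Filtration.

Section FinitePartition.
Context d (T : measurableType d) (R : realType) (P : probability T R).
Implicit Type A : set T.

Lemma probability_fin_split (F : finType) (f : T -> F) A :
  (forall v, measurable (A `&` f @^-1` [set v])) ->
  fine (P A) = \sum_v fine (P (A `&` f @^-1` [set v])).
Proof.
move=> mf.
rewrite sum_fine; last by move=> *; exact: fin_num_measure.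
congr fine; rewrite fsbig_seq ?index_enum_uniq//= -measure_fin_bigcup//.
- congr (P _); rewrite -setI_bigcupr; apply/seteqP; split=> w; last by case.
  move=> Aw; split => //; exists (f w) => //=; exact: mem_index_enum.
- by move=> u v _ _ [w [[_ /= <-] [_ /= <-]]].
Qed.

End FinitePartition.

(** * Conditioning on the loads and the labeling *)

Section Sampling.
Context d (T : measurableType d) (R : realType) (P : probability T R).
Context n (X : allocation_process T n) (t : nat).
Variables (s : T -> 'S_n) (p : T -> 'I_n -> R).
Hypothesis s_adapted : measurable_wrt_discrete (filt X t) s.
Hypothesis p_adapted :
  forall k, measurable_wrt_real (filt X t) (fun w => p w k).
Hypothesis s_sorted : forall w, sorted_labeling R (load X t w) (s w).
Hypothesis p_vector :
  forall w, distribution_vector (p w) /\ majorized_by_uniform (p w).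
Hypothesis bin_law : forall (A : set T) (k : 'I_n), filt X t A ->
  P (A `&` [set w | bin X t w = s w k]) = (\int[P]_(w in A) (p w k)%:E)%E.

(** Loads and labeling are constant on this event, while [p] may still vary there; only its average
    over the event enters. *)
Definition state_event (x : 'I_n -> nat) (sigma : 'S_n) : set T :=
  [set w | load X t w = x] `&` s @^-1` [set sigma].

Lemma filt_state_event x sigma : filt X t (state_event x sigma).
Proof. by apply: filtI; [exact: filt_load|exact: s_adapted]. Qed.

Lemma measurable_state_event x sigma : measurable (state_event x sigma).
Proof. by apply: (@filt_measurable _ _ _ X t); exact: filt_state_event. Qed.

Lemma state_event_bin x sigma k :
  state_event x sigma `&` [set w | bin X t w = s w k] =
  state_event x sigma `&` bin X t @^-1` [set sigma k].
Proof.
by apply/seteqP; split => w [[xw <-] /= bw]; split.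
Qed.

Lemma measurable_state_event_bin x sigma i :
  measurable (state_event x sigma `&` bin X t @^-1` [set i]).
Proof.
apply: measurableI; first exact: measurable_state_event.
by apply: (@filt_measurable _ _ _ X t.+1); exact: bin_adapted.
Qed.

Let q x (sigma : 'S_n) (k : 'I_n) : R :=
  fine (P (state_event x sigma `&` bin X t @^-1` [set sigma k])).

Let sum_q x sigma : \sum_k q x sigma k = fine (P (state_event x sigma)).
Proof.
have e k : state_event x sigma `&`
      (fun w => (sigma^-1)%g (bin X t w)) @^-1` [set k] =
    state_event x sigma `&` bin X t @^-1` [set sigma k].
  apply/seteqP; split => w [Aw /=]; first by move=> <-; rewrite permKV.
  by move=> ->; rewrite permK.
rewrite (@probability_fin_split _ _ _ _ _ (fun w => (sigma^-1)%g (bin X t w))).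
  by apply: eq_bigr => k _; rewrite e.
by move=> k; rewrite e; exact: measurable_state_event_bin.
Qed.

(** The majorization inequalities are linear in [p], so they survive integration over the event. *)
Let q_maj x sigma k : (1 <= k <= n)%N ->
  \sum_(j < n | (j < k)%N) q x sigma j <=
  k%:R / n%:R * fine (P (state_event x sigma)).
Proof.
move=> kn; set A := state_event x sigma.
have mA : measurable A by exact: measurable_state_event.
have mp (j : 'I_n) : measurable_fun A (fun w => (p w j)%:E).
  apply/measurable_EFinP; apply: measurable_funTS => _ B mB.
  rewrite setTI; apply: (@filt_measurable _ _ _ X t).
  exact: p_adapted.
rewrite -lee_fin EFinM fineK; last exact: fin_num_measure.
rewrite -sumEFin.
under eq_bigr => j _.
  rewrite fineK; last by apply: fin_num_measure; exact: measurable_state_event_bin.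
  rewrite -state_event_bin bin_law; last exact: filt_state_event.
  over.
rewrite -big_filter -ge0_integral_sum//; last first.
  by move=> j w _; rewrite lee_fin; exact: (p_vector w).1.1.
rewrite -(integral_cst P mA); apply: ge0_le_integral => //.
- by move=> w _; apply: sume_ge0 => j _; rewrite lee_fin; exact: (p_vector w).1.1.
- exact: emeasurable_sum.
- by move=> w _; rewrite big_filter sumEFin lee_fin; exact: (p_vector w).2.
Qed.

(** Given a non-null event, the conditional law [p'] of the sampled label is again majorized by the
    uniform distribution, so [sum_round_bound_le] applies to it. On a null event both sides
    vanish. *)
Lemma sampling_drift x (sigma : 'S_n) : (1 < n)%N ->
  \sum_k round_bound R x (sigma k) *
    fine (P (state_event x sigma `&` bin X t @^-1` [set sigma k])) <=
  ((1 - rate R / (64 * n%:R)) * potential R x + 16) *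
    fine (P (state_event x sigma)).
Proof.
move=> n1.
have q0 k : 0 <= q x sigma k by exact: fine_ge0.
have [Q0|Q0] := eqVneq (fine (P (state_event x sigma))) 0.
  have qE k : q x sigma k = 0.
    have /psumr_eq0P : \sum_k q x sigma k = 0 by rewrite sum_q.
    exact.
  by rewrite Q0 mulr0 big1// => k _; rewrite -/(q _ _ _) qE mulr0.
have Qgt0 : 0 < fine (P (state_event x sigma)).
  by rewrite lt_neqAle eq_sym Q0 fine_ge0.
(* Any outcome in the event certifies that [sigma] sorts [x]. *)
have [w [xw sw]] : state_event x sigma !=set0.
  apply/set0P; apply/eqP => A0; move: Q0.
  by rewrite A0 measure0 eqxx.
rewrite -ler_pdivrMr// mulr_suml.
pose p' k := q x sigma k / fine (P (state_event x sigma)).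
have -> : \sum_k round_bound R x (sigma k) *
      fine (P (state_event x sigma `&` bin X t @^-1` [set sigma k])) /
      fine (P (state_event x sigma)) =
    \sum_k p' k * round_bound R x (sigma k).
  by apply: eq_bigr => k _; rewrite /p' /q; ring.
apply: sum_round_bound_le => //.
- by have := s_sorted w; rewrite xw sw.
- split; first by move=> k; rewrite divr_ge0// ltW.
  by rewrite -mulr_suml sum_q divff.
- by move=> k kn; rewrite -mulr_suml ler_pdivrMr//; exact: q_maj.
Qed.

End Sampling.

(** * Evolution of the expected potential *)

Section ExpectedPotential.
Context d (T : measurableType d) (R : realType) (P : probability T R).
Context n (X : allocation_process T n).
Hypothesis n_gt1 : (1 < n)%N.
Hypothesis XP : condition_P1 P X.
Hypothesis XW : condition_W1 R X.
Variable M : nat.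

Local Notation state := {ffun 'I_n -> 'I_M.+1}.

Definition loads (x : state) (j : 'I_n) : nat := x j.

Definition load_event t (x : 'I_n -> nat) : set T := [set w | load X t w = x].

(** When all loads after round [t] are at most [M], this is the expectation of [potential] at time
    [t]. *)
Definition expected_potential t : R :=
  \sum_(x : state) potential R (loads x) * fine (P (load_event t (loads x))).

(** [inord] would send a load above [M] to 0; [truncE] excludes this by hypothesis. *)
Let trunc t w : state := [ffun j => inord (load X t w j)].

Let truncE t x : (forall w j, (load X t w j <= M)%N) ->
  trunc t @^-1` [set x] = load_event t (loads x).
Proof.
move=> tM; apply/seteqP; split => w /=.
  by move=> <-; apply/funext => j; rewrite /loads ffunE inordK// ltnS.
by move=> wx; apply/ffunP => j; rewrite ffunE wx inord_val.
Qed.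

Lemma measurable_load_event t x : measurable (load_event t x).
Proof. by apply: (@filt_measurable _ _ _ X t); exact: filt_load. Qed.

Lemma sum_load_event t A : (forall w j, (load X t w j <= M)%N) ->
  (forall x : state, measurable (A `&` load_event t (loads x))) ->
  fine (P A) = \sum_(x : state) fine (P (A `&` load_event t (loads x))).
Proof.
move=> tM mA.
rewrite (@probability_fin_split _ _ _ _ _ (trunc t)).
  by under eq_bigr do rewrite truncE//.
by move=> x; rewrite truncE.
Qed.

Lemma sum_load_eventT t : (forall w j, (load X t w j <= M)%N) ->
  \sum_(x : state) fine (P (load_event t (loads x))) = 1.
Proof.
move=> tM; rewrite -[RHS]/(fine 1%E) -(probability_setT P) (sum_load_event tM).
  by under [RHS]eq_bigr do rewrite setTI.
by move=> x; rewrite setTI; exact: measurable_load_event.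
Qed.

Lemma expected_potentialS t :
  (forall w j, (load X t w j <= M)%N) ->
  (forall w j, (load X t.+1 w j <= M)%N) ->
  expected_potential t.+1 <=
  (1 - rate R / (64 * n%:R)) * expected_potential t + 16.
Proof.
move=> tM tM1.
have [s [p [s_adapted p_adapted s_sorted p_vector bin_law]]] := XP t.
pose ev (u : state * 'S_n) i :=
  state_event X t s (loads u.1) u.2 `&` bin X t @^-1` [set i].
pose g w := (trunc t w, s w, bin X t w).
have gE v : g @^-1` [set v] = ev v.1 v.2.
  case: v => [[x sigma] i]; rewrite /ev /state_event -/(load_event _ _) -truncE//.
  by apply/seteqP; split => w /=; [case=> <- <- <-|case=> -[<- <-] <-].
have mev u i : measurable (ev u i) by exact: measurable_state_event_bin.
have split_next x' : fine (P (load_event t.+1 (loads x'))) =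
    \sum_v fine (P (load_event t.+1 (loads x') `&` ev v.1 v.2)).
  rewrite (@probability_fin_split _ _ _ _ _ g).
    by under eq_bigr do rewrite gE.
  move=> v; rewrite gE; apply: measurableI => //.
  exact: measurable_load_event.
pose b (u : state * 'S_n) i := round_bound R (loads u.1) i.
(* Split over the loads, labeling and bin before the round and over the loads after it. Each
   nonempty cell contains an outcome that performs the round, so [potential_round] applies there. *)
have step1 : expected_potential t.+1 <=
    \sum_v b v.1 v.2 * fine (P (ev v.1 v.2)).
  have -> : \sum_v b v.1 v.2 * fine (P (ev v.1 v.2)) =
      \sum_(x' : state) \sum_v b v.1 v.2 *
        fine (P (load_event t.+1 (loads x') `&` ev v.1 v.2)).
    rewrite exchange_big; apply: eq_bigr => v _ /=.
    rewrite -mulr_sumr (sum_load_event tM1).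
      by under eq_bigr do rewrite setIC.
    by move=> x'; apply: measurableI => //; exact: measurable_load_event.
  apply: ler_sum => x' _; rewrite split_next mulr_sumr.
  apply: ler_sum => v _.
  have [->|/set0P[w [xw' [[xw sw] iw]]]] :=
      eqVneq (load_event t.+1 (loads x') `&` ev v.1 v.2) set0.
    by rewrite measure0 !mulr0.
  rewrite ler_wpM2r ?fine_ge0//; apply: (@potential_round _ _ (ltnW n_gt1)).
  by have := XW t w; rewrite xw xw' iw.
apply: le_trans step1 _.
rewrite -(pair_bigA _ (fun u i => b u i * fine (P (ev u i))))/=.
apply: (@le_trans _ _ (\sum_(u : state * 'S_n)
    ((1 - rate R / (64 * n%:R)) * potential R (loads u.1) + 16) *
    fine (P (state_event X t s (loads u.1) u.2)))).
  apply: ler_sum => u _; rewrite (reindex_inj (@perm_inj _ u.2))/=.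
  exact: (sampling_drift s_adapted p_adapted s_sorted p_vector bin_law).
rewrite -(pair_bigA _ (fun (x : state) sigma =>
    ((1 - rate R / (64 * n%:R)) * potential R (loads x) + 16) *
    fine (P (state_event X t s (loads x) sigma))))/=.
have sum_s (x : state) : \sum_sigma fine (P (state_event X t s (loads x) sigma)) =
    fine (P (load_event t (loads x))).
  rewrite (@probability_fin_split _ _ _ _ _ s)// => sigma.
  exact: measurable_state_event.
under eq_bigr do rewrite -mulr_sumr sum_s mulrDl -mulrA.
by rewrite big_split/= -!mulr_sumr sum_load_eventT// mulr1.
Qed.

(** The bound is the fixed point of the recursion, [16] divided by [rate / (64 * n)], and the
    initial potential lies below it. *)
Lemma expected_potential_le t :
  (forall w j, (load X t w j <= M)%N) ->
  expected_potential t <= 192 * 64 * 16 * n%:R.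
Proof.
elim: t => [|t IHt] tM.
  rewrite -[leRHS]mulr1 -[X in _ <= _ * X](sum_load_eventT tM) mulr_sumr.
  apply: ler_sum => x _.
  have [->|/set0P[w xw]] := eqVneq (load_event 0 (loads x)) set0.
    by rewrite measure0 !mulr0.
  rewrite ler_wpM2r ?fine_ge0//.
  have y0 j : normalized_load R (loads x) j = 0.
    rewrite /normalized_load /total_load -xw load0 big1 ?mul0r ?subr0//.
    by move=> k _; rewrite load0.
  have n0 : 0 <= n%:R :> R by [].
  have -> : potential R (loads x) =
      expR (rate R * correction R n (total_load (loads x))) * n%:R.
    rewrite /potential; congr (_ * _); rewrite /overload_potential.
    under eq_bigl do rewrite y0 lexx.
    under eq_bigr do rewrite y0 mulr0 expR0.
    by rewrite sumr_const card_ord.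
  rewrite ler_wpM2r//; apply: le_trans (expR_correction_le2 _ _ (ltnW n_gt1)) _.
  by lra.
have tM0 w j : (load X t w j <= M)%N.
  by apply: leq_trans (tM w j); exact: load_le XW _ _ _ _ (leqnSn t).
apply: le_trans (expected_potentialS tM0 tM) _.
have n0 : 0 < n%:R :> R by rewrite ltr0n ltnW.
have c0 : 0 <= 1 - rate R / (64 * n%:R).
  rewrite subr_ge0 ler_pdivrMr ?mulr_gt0// mul1r /rate.
  have : 1 <= n%:R :> R by rewrite ler1n ltnW.
  by lra.
have := ler_wpM2l c0 (IHt tM0).
have -> : (1 - rate R / (64 * n%:R)) * (192 * 64 * 16 * n%:R) =
    192 * 64 * 16 * n%:R - 16 :> R.
  by rewrite /rate; field; rewrite gt_eqF.
by lra.
Qed.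

End ExpectedPotential.

(** * From the potential to the gap *)

Lemma gap_normalized_load (R : realType) n (x : 'I_n -> nat) : (0 < n)%N ->
  exists j, gap R x = normalized_load R x j.
Proof.
move=> n0; have [|j xj] := bigop.eq_bigmax x; first by rewrite card_ord.
by exists j; rewrite /gap /normalized_load xj.
Qed.

(** The fullest bin alone contributes enough, since [768 * rate = 4]. *)
Lemma potential_gap (R : realType) n (x : 'I_n -> nat) : (0 < n)%N ->
  768 * ln n%:R < gap R x -> n%:R ^+ 4 <= potential R x.
Proof.
move=> n0; have [j ->] := gap_normalized_load R x n0 => xj.
have nR0 : 0 < n%:R :> R by rewrite ltr0n.
have ln0 : 0 <= ln n%:R :> R by rewrite ln_ge0// ler1n.
apply: (@le_trans _ _ (overload_potential R x)); last first.
  rewrite /potential ler_peMl ?overload_potential_ge0// -expR0 ler_expR.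
  by rewrite mulr_ge0 ?correction_ge0// ltW// rate_gt0.
rewrite /overload_potential (bigD1 j)/=; last by lra.
apply: (@le_trans _ _ (expR (rate R * normalized_load R x j))); last first.
  by rewrite lerDl; apply: sumr_ge0 => k _; exact: expR_ge0.
rewrite -[n%:R]lnK ?posrE// -expRM_natl ler_expR /rate.
by lra.
Qed.

Theorem mainTheorem1 (R : realType) :
  exists2 C : R, 0 < C &
  exists N : nat, forall n : nat, (N <= n)%N ->
  forall (d : measure_display) (T : measurableType d) (P : probability T R)
         (X : allocation_process T n),
    condition_P1 P X -> condition_W1 R X ->
    forall m : nat, (1 <= m)%N ->
      ((1 - n%:R ^- 2)%:E
         <= P [set w | (gap R (load X m w) <= C * ln n%:R)%R])%E.
Proof.
(* For [n >= N] the expected potential is at most [n ^+ 2]. *)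
have [N N1 NR] : exists2 N, (1 < N)%N & 192 * 64 * 16 <= N%:R :> R.
  exists (Num.bound (192 * 64 * 16 : R)).+2 => //.
  apply: le_trans (ltW (archi_boundP _)) _; last by rewrite ler_nat ltnW.
  by rewrite !mulr_ge0.
exists 768; first by rewrite ltr0n.
exists N => n Nn d T P X XP XW m _.
have n1 : (1 < n)%N by exact: leq_trans Nn.
have n0 : (0 < n)%N by exact: ltnW.
have nR0 : 0 < n%:R :> R by rewrite ltr0n.
have NnR : 192 * 64 * 16 <= n%:R :> R by rewrite (le_trans NR)// ler_nat.
have [M XM] := load_bounded XW m.
pose good := [set w | gap R (load X m w) <= 768 * ln n%:R].
rewrite -/good.
suff : 1 - n%:R ^- 2 <= fine (P good).
  have : (0 <= P good)%E by exact: measure_ge0.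
  by case: (P good) => [r _|_ _|//]; [rewrite lee_fin|exact: leey].
pose state := {ffun 'I_n -> 'I_M.+1}.
pose small (x : state) := gap R (loads x) <= 768 * ln n%:R.
have goodE (x : state) : good `&` load_event X m (loads x) =
    if small x then load_event X m (loads x) else set0.
  rewrite /small; case: ifPn => xs; apply/seteqP; split => w //=.
  - by case.
  - by move=> wx; split => //; rewrite /good/= wx.
  - by rewrite /good/= => -[+ wx]; rewrite wx (negbTE xs).
rewrite (sum_load_event _ XM); last first.
  by move=> x; rewrite goodE; case: ifP => // _; exact: measurable_load_event.
have -> : \sum_(x : state) fine (P (good `&` load_event X m (loads x))) =
    \sum_(x : state | small x) fine (P (load_event X m (loads x))).
  rewrite [RHS]big_mkcond; apply: eq_bigr => x _; rewrite goodE.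
  by case: ifP => // _; rewrite measure0.
have := sum_load_eventT P XM; rewrite (bigID small)/= => tot.
suff : \sum_(x : state | ~~ small x) fine (P (load_event X m (loads x)))
    <= n%:R ^- 2 by lra.
(* Markov's inequality at level [n ^+ 4]. *)
have : (\sum_(x : state | ~~ small x) fine (P (load_event X m (loads x))))
    * n%:R ^+ 4 <= expected_potential P X M m.
  rewrite mulr_suml big_mkcond; apply: ler_sum => x _ /=.
  case: ifPn => xs.
    rewrite mulrC ler_wpM2r ?fine_ge0//; apply: potential_gap => //.
    by rewrite ltNge.
  rewrite mulr_ge0 ?fine_ge0// mulr_ge0 ?expR_ge0//.
  exact: overload_potential_ge0.
move=> /le_trans/(_ (expected_potential_le n1 XP XW XM)) h.
rewrite -(ler_pM2r (exprn_gt0 4 nR0)); apply: le_trans h _.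
rewrite [leRHS](_ : _ = n%:R ^+ 2); last by field; rewrite gt_eqF.
by rewrite expr2 ler_wpM2r// ltW.
Qed.
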